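(* Any algorithm that achieves approximation ratio better than $3/2$ for All-Nodes Shortest Cycles on unweighted undirected $n$-vertex graphs with $m=\Theta(n^2)$ edges, where the input graph is given as an adjacency matrix, requires $\Omega(n^2)$ time (unconditionally).
   Context: All-Nodes Shortest Cycles: for every vertex $v$ compute $SC(v)$, the length of a shortest (simple) cycle through $v$; approximation ratio $\alpha$ means estimates $\hat c_v$ with $SC(v)\le\hat c_v\le\alpha SC(v)$ for all $v$. *)

(* Defs.v *)
From mathcomp Require Import all_boot all_order all_algebra.
From mathcomp Require Import boolp classical_sets reals constructive_ereal ereal.

Set Implicit Arguments.
Unset Strict Implicit.
Unset Printing Implicit Defensive.

Import Order.TTheory GRing.Theory Num.Theory.
Local Open Scope classical_set_scope.
Local Open Scope ring_scope.

Definition is_graph n (M : 'M[bool]_n) : Prop :=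
  (forall i, ~~ M i i) /\ (forall i j, M i j = M j i).

Definition num_edges n (M : 'M[bool]_n) : nat :=
  #|[pred e : 'I_n * 'I_n | (e.1 < e.2)%N && M e.1 e.2]|.

Definition cycle_through n (M : 'M[bool]_n) (v : 'I_n) (c : seq 'I_n) : Prop :=
  [/\ (3 <= size c)%N, ucycle (fun i j => M i j) c & v \in c].

(* +oo when v lies on no cycle. *)
Definition SC (R : realType) n (M : 'M[bool]_n) (v : 'I_n) : \bar R :=
  ereal_inf [set ((size c)%:R)%:E | c in cycle_through M v].

Definition approx_SC (R : realType) (alpha : R) n (M : 'M[bool]_n)
    (est : 'I_n -> \bar R) : Prop :=
  forall v, (SC R M v <= est v)%E /\ (est v <= alpha%:E * SC R M v)%E.

(* One unit of time. The input matrix is accessible only through Probe, which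
   reads a single entry; Draw k moves to one of k.+1 successors uniformly at
   random. *)
Inductive action (R : realType) (n : nat) (S : Type) : Type :=
| Compute of S
| Probe of 'I_n & 'I_n & (bool -> S)
| Draw (k : nat) of ('I_k.+1 -> S)
| Halt of ('I_n -> \bar R).

(* A possibly randomized algorithm, as an abstract state machine started with
   only n known. States are unrestricted (they stand for the whole content of
   memory, registers and program counter), so that random-access machines,
   uniform or not and with any instruction set whose instructions each read at
   most one input entry, are instances with the same number of steps; a
   deterministic algorithm is one that never uses Draw. *)
Record algorithm (R : realType) := Algorithm {
  state : nat -> Type;
  init : forall n, state n;
  step : forall n, state n -> action R n (state n) }.

(* Probability that A, run on M from state s, halts within t steps with an
   output satisfying good. *)
Fixpoint prob_from (R : realType) (A : algorithm R) n (M : 'M[bool]_n)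
    (good : ('I_n -> \bar R) -> Prop) (t : nat) (s : state A n) : R :=
  if t is t'.+1 then
    match step s with
    | Compute s' => prob_from M good t' s'
    | Probe i j next => prob_from M good t' (next (M i j))
    | Draw k next =>
        (\sum_(i < k.+1) prob_from M good t' (next i)) / k.+1%:R
    | Halt est => if `[< good est >] then 1 else 0
    end
  else 0.

Definition prob_within (R : realType) (A : algorithm R) n (M : 'M[bool]_n)
    (good : ('I_n -> \bar R) -> Prop) (t : nat) : R :=
  prob_from M good t (init A n).

Definition dense_graph (R : realType) (a b : R) n (M : 'M[bool]_n) : Prop :=
  is_graph M /\
  a * n%:R ^+ 2 <= (num_edges M)%:R /\ (num_edges M)%:R <= b * n%:R ^+ 2.

(* Worst case over inputs, error probability at most 1/3. *)
Definition approximates_in_time (R : realType) (a b alpha : R)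
    (A : algorithm R) (T : nat -> nat) : Prop :=
  forall n (M : 'M[bool]_n), dense_graph a b M ->
    2%:R / 3%:R <= prob_within A M (approx_SC alpha M) (T n).

Definition at_least_quadratic (R : realType) (T : nat -> nat) : Prop :=
  exists c : R, 0 < c /\ exists n0 : nat, forall n : nat, (n0 <= n)%N ->
    c * n%:R ^+ 2 <= (T n)%:R.

(* Main.v *)
(* Take a clique on the first k vertices, and a star centred at vertex k whose
   leaves are all the later vertices; k is chosen so that the density lies
   strictly between a and b.  No leaf lies on a cycle, so a correct output is
   +oo at every leaf, but joining two leaves puts both on a triangle, where a
   correct output is finite.  An algorithm correct on both inputs with
   probability 2/3 must, on the star input, probe the joining pair with
   probability at least 1/3.  These probabilities add up to at most the running
   time, and there are quadratically many pairs of leaves. *)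
Require Import Defs.
From mathcomp Require Import all_boot all_order all_algebra.
From mathcomp Require Import boolp classical_sets reals constructive_ereal ereal.
From mathcomp Require Import zify ring lra.

Set Implicit Arguments.
Unset Strict Implicit.
Unset Printing Implicit Defensive.

Import Order.TTheory GRing.Theory Num.Theory.
Local Open Scope ring_scope.

(** * Distinguishing two inputs by probes *)

(* Probability that the run on M probes, within t steps, an entry on which M and
   M' differ. *)
Fixpoint differing_probe (R : realType) (A : algorithm R) n (M M' : 'M[bool]_n)
    (t : nat) (s : state A n) : R :=
  if t is t'.+1 then
    match step s with
    | Compute s' => differing_probe M M' t' s'
    | Probe i j next =>
        if M i j != M' i j then 1 else differing_probe M M' t' (next (M i j))
    | Draw k next =>
        (\sum_(i < k.+1) differing_probe M M' t' (next i)) / k.+1%:R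
    | Halt _ => 0
    end
  else 0.

Lemma mean_le (R : realType) k (F : 'I_k.+1 -> R) (c : R) :
  (forall i, F i <= c) -> (\sum_(i < k.+1) F i) / k.+1%:R <= c.
Proof.
move=> Fc; rewrite ler_pdivrMr ?ltr0Sn //.
apply: le_trans (ler_sum _ (fun i _ => Fc i)) _.
by rewrite sumr_const card_ord mulr_natr.
Qed.

Section Probing.
Variables (R : realType) (A : algorithm R) (n : nat).
Implicit Types (M : 'M[bool]_n) (s : state A n).

Lemma prob_from_le1 M good t s : prob_from M good t s <= 1.
Proof.
elim: t s => [|t IH] s /=; first exact: ler01.
case: (step s) => [s'|i j next|k next|est] //; first exact: mean_le.
by case: ifP.
Qed.

Lemma differing_probe_ge0 M M' t s : 0 <= differing_probe M M' t s.
Proof.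
elim: t s => [|t IH] s //=.
case: (step s) => [s'|i j next|k next|est] //; first by case: ifP.
by rewrite mulr_ge0 ?invr_ge0 ?ler0n ?sumr_ge0.
Qed.

(** Couple the two runs by giving them the same draws. Until an entry on which the inputs differ is
    probed they coincide, and a common output satisfies at most one of [good] and [good']. At such a
    probe, bounding each probability by 1 is enough. *)
Lemma prob_from_disjoint M M' (good good' : ('I_n -> \bar R) -> Prop) t s :
  (forall est, good est -> ~ good' est) ->
  prob_from M good t s + prob_from M' good' t s <= 1 + differing_probe M M' t s.
Proof.
move=> disj; elim: t s => [|t IH] s /=; first by rewrite !addr0.
case: (step s) => [s'|i j next|k next|est] //.
- case: eqVneq => [->|_] /=; first exact: IH.
  by rewrite lerD ?prob_from_le1.
- rewrite -mulrDl -big_split /= -lerBlDr -mulrBl -sumrB.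
  by apply: mean_le => i; rewrite lerBlDr IH.
- rewrite addr0; case: asboolP => [g|_]; last by rewrite add0r; case: ifP.
  by case: asboolP => [/(disj _ g)|]; rewrite ?addr0.
Qed.

(** All the summands concern the same run on [M], and a single probe can tell at most one [M_ e]
    from [M], so each step adds at most 1 to the sum. *)
Lemma sum_differing_probe M (I : finType) (P : pred I) (M_ : I -> 'M[bool]_n)
    t s :
  (forall i j, (\sum_(e | P e) (M i j != M_ e i j) <= 1)%N) ->
  \sum_(e | P e) differing_probe M (M_ e) t s <= t%:R.
Proof.
move=> diff1; elim: t s => [|t IH] s /=; first by rewrite big1.
have IH1 s' : \sum_(e | P e) differing_probe M (M_ e) t s' <= t.+1%:R.
  by rewrite (le_trans (IH s')) // ler_nat.
case: (step s) => [s'|i j next|k next|est] //.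
- rewrite -addn1 natrD addrC.
  have := diff1 i j; rewrite -(ler_nat R) => /lerD /(_ (IH (next (M i j)))).
  apply: le_trans; rewrite natr_sum -big_split /=; apply: ler_sum => e _.
  by case: ifP => _ /=; rewrite ?add0r // lerDl differing_probe_ge0.
- by rewrite -mulr_suml exchange_big /=; apply: mean_le.
- by rewrite big1.
Qed.

(** Success on both [M] and [M_ e] forces a differing probe with probability at least [2 * p - 1];
    summing over [e] compares this with the running time. *)
Lemma card_disjoint_le_time M (I : finType) (P : pred I)
    (M_ : I -> 'M[bool]_n) (good : ('I_n -> \bar R) -> Prop)
    (good_ : I -> ('I_n -> \bar R) -> Prop) (p : R) t :
  (forall i j, (\sum_(e | P e) (M i j != M_ e i j) <= 1)%N) ->
  (forall e, P e -> forall est, good est -> ~ good_ e est) ->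
  p <= prob_within A M good t ->
  (forall e, P e -> p <= prob_within A (M_ e) (good_ e) t) ->
  (2 * p - 1) * #|P|%:R <= t%:R.
Proof.
move=> diff1 disj pM pM_.
apply: le_trans (sum_differing_probe t (init A n) diff1).
rewrite mulr_natr -sumr_const; apply: ler_sum => e Pe.
have := prob_from_disjoint M (M_ e) t (init A n) (disj e Pe).
move: pM (pM_ e Pe); rewrite /prob_within; lra.
Qed.

End Probing.

(** * Estimates at vertices on a cycle and on no cycle *)

Lemma SC_acyclic (R : realType) n (M : 'M[bool]_n) v :
  (forall c, ~ cycle_through M v c) -> SC R M v = +oo%E.
Proof.
move=> acyc; apply/eqP; rewrite -leye_eq.
by apply/ereal_infP => y [c /acyc].
Qed.

Lemma SC_fin_num (R : realType) n (M : 'M[bool]_n) v c :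
  cycle_through M v c -> SC R M v \is a fin_num.
Proof.
move=> cyc; rewrite fin_numE; apply/andP; split.
- rewrite gt_eqF //; apply: lt_le_trans (ltNyr 0) _.
  by apply/ereal_infP => _ [c' _ <-]; rewrite lee_fin ler0n.
- rewrite lt_eqF //; apply: le_lt_trans (ltry (size c)%:R).
  by apply: ereal_inf_lbound; exists c.
Qed.

(** The lower bound for [M] forces the estimate at [v] to be [+oo], while the upper bound for [M']
    is a real multiple of a finite number. *)
Lemma approx_SC_disjoint (R : realType) (alpha : R) n (M M' : 'M[bool]_n) v c :
  (forall c', ~ cycle_through M v c') -> cycle_through M' v c ->
  forall est, approx_SC alpha M est -> ~ approx_SC alpha M' est.
Proof.
move=> acyc cyc est /(_ v)[+ _].
rewrite (SC_acyclic R acyc) leye_eq => /eqP est_oo /(_ v)[_]; rewrite est_oo.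
by rewrite -(fineK (SC_fin_num R cyc)) -EFinM leye_eq.
Qed.

(** * The hard inputs: edge counts and cycles *)

Definition clique_star n k : 'M[bool]_n :=
  \matrix_(i, j) ((i != j) &&
    [|| (i < k) && (j < k), (i == k :> nat) && (k < j)
      | (j == k :> nat) && (k < i)])%N.

Definition add_edge n (M : 'M[bool]_n) (u w : 'I_n) : 'M[bool]_n :=
  \matrix_(i, j) [|| M i j, (i == u) && (j == w) | (i == w) && (j == u)].

Lemma clique_star_graph n k : is_graph (clique_star n k).
Proof.
split=> [i|i j]; rewrite !mxE ?eqxx // eq_sym.
by congr (_ && _); rewrite andbC; congr (_ || _); rewrite orbC.
Qed.

Lemma add_edge_graph n (M : 'M[bool]_n) u w :
  u != w -> is_graph M -> is_graph (add_edge M u w).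
Proof.
move=> uw [irr sym]; split=> [i|i j]; rewrite !mxE.
  rewrite (negbTE (irr i)) /=; apply/norP.
  by split; apply: contra uw => /andP[/eqP <- /eqP <-].
rewrite sym; congr (_ || _).
by rewrite orbC andbC; congr (_ || _); rewrite andbC.
Qed.

Lemma card_le_cover (T : finType) (A B C : simpl_pred T) :
  (forall x, A x -> B x || C x) -> (#|A| <= #|B| + #|C|)%N.
Proof.
move=> ABC; rewrite -cardUI; apply: leq_trans (leq_addr _ _).
by apply: subset_leq_card; apply/fintype.subsetP => x /ABC.
Qed.

Lemma card_ltn_pairs n m : (m <= n)%N ->
  #|[pred e : 'I_n * 'I_n | (e.1 < e.2 < m)%N]| = 'C(m, 2).
Proof.
move=> mn; rewrite -bin2_sum big_mkord (big_ord_widen n id mn) -sum1_card.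
transitivity (\sum_(j < n | (j < m)%N) \sum_(i < n | (i < j)%N) 1)%N.
  rewrite (exchange_big_dep predT) //= pair_big_dep.
  by apply: eq_bigl => -[i j] /=; rewrite inE andbC.
apply: eq_bigr => j _.
by rewrite -(big_ord_widen n (fun=> 1%N) (ltnW (ltn_ord j))) sum1_card card_ord.
Qed.

Lemma card_gtn_pairs n k :
  #|[pred e : 'I_n * 'I_n | (k < e.1 < e.2)%N]| = 'C(n - k.+1, 2).
Proof.
rewrite -(card_ltn_pairs (leq_subr k.+1 n)).
(* Reversing the vertex order sends the vertices after [k] to the first [n - k.+1]; swapping the
   components keeps pairs increasing. *)
pose f (e : 'I_n * 'I_n) := (rev_ord e.2, rev_ord e.1).
have fK : involutive f by case=> i j; rewrite /f /= !rev_ordK.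
rewrite -!sum1_card (reindex_inj (inv_inj fK)) /=.
by apply: eq_bigl => -[i j] /=; rewrite !inE /=; lia.
Qed.

Lemma num_edges_add n (M : 'M[bool]_n) (u w : 'I_n) : (u < w)%N ->
  (num_edges M <= num_edges (add_edge M u w) <= (num_edges M).+1)%N.
Proof.
move=> uw; apply/andP; split.
  apply: subset_leq_card; apply/fintype.subsetP => -[i j].
  by rewrite !inE /= mxE => /andP[-> ->].
have : (#|pred1 (u, w)| <= 1)%N by rewrite card1.
rewrite -(leq_add2r (num_edges M)) add1n; apply: leq_trans.
rewrite /num_edges; apply: card_le_cover => -[i j].
rewrite /= mxE xpair_eqE => /andP[ij /or3P[->|->//|/andP[/eqP iw /eqP ju]]].
  by rewrite ij orbT.
by move: ij uw; rewrite iw ju; lia.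
Qed.

Lemma num_edges_clique_star n k : (k < n)%N ->
  ('C(k, 2) <= num_edges (clique_star n k) <= 'C(k, 2) + n)%N.
Proof.
move=> kn; rewrite -(card_ltn_pairs (ltnW kn)); apply/andP; split.
  apply: subset_leq_card; apply/fintype.subsetP => -[i j].
  rewrite !inE /= mxE -val_eqE /=; lia.
(* Listed with the smaller endpoint first, all star edges lie in row [k], which has [n] entries. *)
have card_row : #|[predX pred1 (Ordinal kn) & 'I_n]| = n.
  by rewrite cardX card1 mul1n card_ord.
rewrite -[X in (_ + X)%N]card_row; apply: card_le_cover => -[i j].
rewrite !inE /= mxE -!val_eqE /=; lia.
Qed.

Lemma clique_star_leaf n k (v : 'I_n) : (k < v)%N ->
  forall c, ~ cycle_through (clique_star n k) v c.
Proof.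
move=> kv c [sz /andP[cyc uniqc] vc].
(* Rotate the cycle to start at [v]. The successor and the predecessor of [v] must both be its only
   neighbour [k], but on a cycle of length at least 3 they are distinct. *)
have [i c' rotc] := rot_to vc.
move: sz cyc uniqc; rewrite -(size_rot i) -(rot_cycle i) -(rot_uniq i) rotc.
case: c' {rotc} => [|x [|y s]] //= _; rewrite rcons_path !mxE.
move=> vx_pv /and3P[_ + _]; suff -> : x = last y s by rewrite mem_last.
apply: val_inj; move: vx_pv => /=; lia.
Qed.

Lemma add_edge_triangle n k (u w : 'I_n) : (k < u < w)%N ->
  exists c, cycle_through (add_edge (clique_star n k) u w) u c.
Proof.
move=> kuw; have kn : (k < n)%N by have := ltn_ord u; lia.
exists [:: u; w; Ordinal kn]; split; rewrite ?mem_head //.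
rewrite /ucycle /= !mxE !inE -!val_eqE /=; lia.
Qed.

Lemma add_edge_differ n (M : 'M[bool]_n) (P : pred ('I_n * 'I_n)) (i j : 'I_n) :
  (forall e, P e -> e.1 < e.2)%N ->
  (\sum_(e | P e) (M i j != add_edge M e.1 e.2 i j) <= 1)%N.
Proof.
(* [e0] is the only increasing pair whose addition can change entry [(i, j)]. *)
move=> Plt; pose e0 := if (i < j)%N then (i, j) else (j, i).
rewrite -[X in (_ <= X)%N](card1 e0) -big_mkcondr sum1_card.
apply: subset_leq_card; apply/fintype.subsetP => -[u w].
rewrite inE unfold_in /= !mxE /e0 => /andP[/Plt/= uw].
case: (M i j) => //= /negPf/negbFE/orP[] /andP[/eqP -> /eqP ->].
  by rewrite uw.
by rewrite ltnNge (ltnW uw).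
Qed.

(** * Choosing the clique size *)

Lemma bin2R (R : realType) m : 'C(m, 2)%:R * 2 = m%:R * (m%:R - 1) :> R.
Proof.
elim: m => [|m IH]; first by rewrite bin0n !mul0r.
by rewrite binS bin1 natrD mulrDl IH -natr1; ring.
Qed.

(** A clique on about [c * n] vertices has about [c ^+ 2 / 2 * n ^+ 2] edges; [c < 1] leaves a
    linear number of leaves. The target density [d] is the midpoint of [a] and the smaller of [b]
    and 1/2. *)
Lemma half_sqr_between (R : realType) (a b : R) :
  0 < a -> a < b -> a < 2^-1 ->
  exists c : R, [/\ 0 < c, c < 1, a < c ^+ 2 / 2 & c ^+ 2 / 2 < b].
Proof.
move=> a0 ab a2.
have [d [ad db d2]] : exists d : R, [/\ a < d, d < b & d < 2^-1].
  have [b2|b2] := leP b 2^-1; [exists ((a + b) / 2)|exists ((a + 2^-1) / 2)];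
    split; lra.
exists (Num.sqrt (2 * d)); rewrite sqr_sqrtr; last by lra.
split; [by rewrite sqrtr_gt0; lra| |lra|lra].
by rewrite -[ltRHS]sqrtr1 ltr_sqrt; lra.
Qed.

(** Take [k] to be [c * n] rounded down. The term [n] allows for the star, the successor for the
    added edge, and the last bound counts pairs of leaves. *)
Lemma clique_size_bounds (R : realType) (a b c : R) :
  0 < a -> 0 < c -> c < 1 -> a < c ^+ 2 / 2 -> c ^+ 2 / 2 < b ->
  exists n0 : nat, forall n : nat, (n0 <= n)%N -> exists k : nat,
    [/\ (k < n)%N, a * n%:R ^+ 2 <= 'C(k, 2)%:R,
        ('C(k, 2) + n).+1%:R <= b * n%:R ^+ 2 &
        (1 - c) ^+ 2 / 8 * n%:R ^+ 2 <= 'C(n - k.+1, 2)%:R].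
Proof.
move=> a0 c0 c1 ac cb.
(* [eps] is below all three gaps, so once [eps * n] is at least 4 each quadratic slack absorbs the
   linear rounding errors. *)
have [eps [eps0 epsa epsb epsc]] : exists eps : R,
    [/\ 0 < eps, eps <= c ^+ 2 / 2 - a, eps <= b - c ^+ 2 / 2 & eps <= 1 - c].
  exists (Num.min (Num.min (c ^+ 2 / 2 - a) (b - c ^+ 2 / 2)) (1 - c)).
  by rewrite !lt_min !ge_min !lexx !subr_gt0 ac cb c1 !orbT.
exists (Num.bound (4 / eps)) => n n0n.
have n4 : 4 <= eps * n%:R.
  rewrite mulrC -ler_pdivrMr //; apply/ltW.
  apply: lt_le_trans (archi_boundP _) _; last by rewrite ler_nat.
  by rewrite divr_ge0 // ltW.
have n_gt0 : 0 < n%:R :> R by rewrite -(pmulr_rgt0 _ eps0) (lt_le_trans _ n4).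
have epsn (x : R) : eps <= x -> 4 <= x * n%:R.
  by move=> ex; apply: le_trans n4 _; rewrite ler_wpM2r // ltW.
have {}epsa := epsn _ epsa; have {}epsb := epsn _ epsb.
have {}epsc := epsn _ epsc.
have n1 : 1 <= n%:R :> R by rewrite (ler_nat R 1) -(ltr_nat R).
have cn0 : 0 <= c * n%:R by rewrite mulr_ge0 // ltW.
pose k := Num.truncn (c * n%:R).
have /andP[kle klt] : k%:R <= c * n%:R < k.+1%:R by exact: truncn_itv.
have kn : (k < n)%N.
  by rewrite -(ltr_nat R) (le_lt_trans kle) // gtr_pMl.
exists k; have binR := bin2R R k; have binR' := bin2R R (n - k.+1).
move: klt binR'; rewrite natrB // -natr1 => klt binR'.
have k0 : 0 <= k%:R :> R by [].
split => //.
- rewrite -(ler_pM2r (_ : 0 < 2)) // binR.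
  have cn2 : 2 <= c * n%:R.
    have : 0 <= a * n%:R by rewrite mulr_ge0 // ltW.
    have : c * (c * n%:R) <= c * n%:R by rewrite ler_piMl // ltW.
    lra.
  (* With [x = c * n], this product expands to [k * (k - 1) - (x ^+ 2 - 3 * x + 2)]. *)
  have : 0 <= (k%:R - c * n%:R + 1) * (k%:R + c * n%:R - 2).
    by rewrite mulr_ge0; lra.
  have : 4 * n%:R <= (c ^+ 2 / 2 - a) * n%:R * n%:R by rewrite ler_pM2r.
  have : c * n%:R <= n%:R by rewrite ler_piMl // ltW.
  lra.
- have : 4 * n%:R <= (b - c ^+ 2 / 2) * n%:R * n%:R by rewrite ler_pM2r.
  have : k%:R * k%:R <= c * n%:R * (c * n%:R) by rewrite ler_pM.
  rewrite -addn1 !natrD; lra.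
- have : (1 - c) * n%:R / 2 * ((1 - c) * n%:R / 2) <=
      (n%:R - (k%:R + 1)) * (n%:R - (k%:R + 1) - 1) by rewrite ler_pM; lra.
  lra.
Qed.

(* A simple graph on n vertices has fewer than n^2 / 2 edges, so for
   a >= 1/2 no input has a n^2 edges or more. *)
Theorem theorem14 (R : realType) (a b : R) (ha : 0 < a) (hab : a < b)
    (ha2 : a < 2%:R^-1) (alpha : R) (halpha : alpha < 3%:R / 2%:R)
    (A : algorithm R) (T : nat -> nat)
    (hA : approximates_in_time a b alpha A T) :
  at_least_quadratic R T.
Proof.
have [c [c0 c1 ac cb]] := half_sqr_between ha hab ha2.
have [n0 size_k] := clique_size_bounds ha c0 c1 ac cb.
(* The leaf pairs contribute [(1 - c) ^+ 2 / 8], and the probing probability [2 * (2 / 3) - 1] the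
   factor 1/3. *)
exists ((1 - c) ^+ 2 / 24); split.
  by rewrite divr_gt0 // exprn_gt0 // subr_gt0.
exists n0 => n /size_k[k [kn edges_ge edges_le leaves]].
pose P := [pred e : 'I_n * 'I_n | (k < e.1 < e.2)%N].
pose M := clique_star n k; pose M_ (e : 'I_n * 'I_n) := add_edge M e.1 e.2.
have /andP[M_ge M_le] := num_edges_clique_star kn.
(* One spare edge lets this cover both [M] and every [M_ e]. *)
have dense (M' : 'M[bool]_n) : is_graph M' ->
    (num_edges M <= num_edges M' <= (num_edges M).+1)%N -> dense_graph a b M'.
  move=> M'g /andP[M'_ge M'_le]; split=> //; split.
    by apply: le_trans edges_ge _; rewrite ler_nat (leq_trans M_ge).
  by apply: le_trans _ edges_le; rewrite ler_nat (leq_trans M'_le).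
have graphM : is_graph M := clique_star_graph n k.
have : (2 * (2 / 3) - 1) * #|P|%:R <= (T n)%:R :> R.
  apply: (@card_disjoint_le_time R A n M _ P M_ (approx_SC alpha M)
            (fun e => approx_SC alpha (M_ e))).
  - by move=> i j; apply: add_edge_differ => e /andP[].
  - move=> e /= Pe; have [tri cyc] := add_edge_triangle Pe.
    apply: approx_SC_disjoint cyc; apply: clique_star_leaf.
    by case/andP: Pe.
  - by apply/hA/dense; rewrite ?leqnn ?leqnSn.
  - move=> e /andP[_ lt_e]; apply/hA/dense; last exact: num_edges_add.
    by apply: add_edge_graph; rewrite // -val_eqE ltn_eqF.
rewrite card_gtn_pairs; lra.
Qed.
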